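(* Consider the JSS-ERM problem of minimizing $C(\mathbf d,b,w)$ over $\mathbf d\in\mathfrak D$, $b=(b_a^s)$ and $w=(w_{i,e}^s)$ subject to (i) $C_i(\mathbf d,b,w)\le T_i^{ex}$ for all $i\in\mathcal N$; (ii) $\sum_{s\in\mathcal S} b_a^s\le 1$ for all $a\in\mathcal A$; (iii) $\sum_{j\in O_{(e,s)}(\mathbf d)} w_{j,e}^s\le 1$ for all $e\in\mathcal E$, $s\in\mathcal S$; (iv) $b_a^s\ge 0$ for all $a,s$; (v) $w_{i,e}^s\ge 0$ for all $i,e,s$. Given the optimal allocation coefficients $\hat b,\hat w$ (as functions of $\mathbf d$, defined in the context), the decomposition-based algorithm, which computes a decision vector $\mathbf d^*$ by the COS algorithm and sets the coefficients to $\hat b(\mathbf d^* ),\hat w(\mathbf d^* )$, computes a $2.62$-approximate solution to the JSS-ERM problem, i.e. its cost is at most $2.62$ times the optimal value.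
   Context: Finite sets $\mathcal N=\{1,\dots,N\}$ of wireless devices (WDs), $\mathcal A$ of access points (APs), $\mathcal C$ of edge clouds (ECs), $\mathcal S$ of slices; $\mathcal E=\mathcal A\cup\mathcal C$ (disjoint union). Given positive numbers $D_i$, $R_{i,a}$, $L_i$, $L_{i,s}$, $F_c^s$, $F_i^l$ for $i\in\mathcal N$, $a\in\mathcal A$, $c\in\mathcal C$, $s\in\mathcal S$, put $T_i^{ex}=L_i/F_i^l$, $E_{i,a}^s=D_i/R_{i,a}$ for $a\in\mathcal A$, and $E_{i,c}^s=L_{i,s}/F_c^s$ for $c\in\mathcal C$. Decisions: $\mathfrak D_i=\{i\}\cup(\mathcal A\times\mathcal C\times\mathcal S)$ ($d_i=i$: local computing; $d_i=(a,c,s)$: offloading through AP $a$ to EC $c$ in slice $s$); $\mathfrak D=\prod_i\mathfrak D_i$. $O_{(a,s)}(\mathbf d)=\{i: d_i=(a,\cdot,s)\}$, $O_{(c,s)}(\mathbf d)=\{i: d_i=(\cdot,c,s)\}$, $O_l(\mathbf d)=\{i:d_i=i\}$. Coefficients: $b_a^s$ for $a\in\mathcal A$, with the convention $b_c^s=1$ for $c\in\mathcal C$; $w_{i,e}^s$ for $i\in\mathcal N,e\in\mathcal E,s\in\mathcal S$. Cost of WD $i$: $C_i(\mathbf d,b,w)=\frac{E_{i,a}^s}{b_a^s w_{i,a}^s}+\frac{E_{i,c}^s}{w_{i,c}^s}$ if $d_i=(a,c,s)$, and $T_i^{ex}$ if $d_i=i$ (division of a positive number by $0$ gives $+\infty$).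 System cost: $$C(\mathbf d,b,w)=\sum_{s\in\mathcal S}\sum_{e\in\mathcal E}\sum_{i\in O_{(e,s)}(\mathbf d)}\frac{E_{i,e}^s}{b_e^s w_{i,e}^s}+\sum_{i\in O_l(\mathbf d)}T_i^{ex}.$$ Optimal allocation coefficients for $\mathbf d$: $\hat w_{i,e}^s=\sqrt{E_{i,e}^s}\big/\sum_{j\in O_{(e,s)}(\mathbf d)}\sqrt{E_{j,e}^s}$ for $i\in O_{(e,s)}(\mathbf d)$, and $\hat b_a^s=\sum_{j\in O_{(a,s)}(\mathbf d)}\sqrt{E_{j,a}^s}\big/\sum_{s'\in\mathcal S}\sum_{j\in O_{(a,s')}(\mathbf d)}\sqrt{E_{j,a}^{s'}}$ for APs $a$ used by at least one WD (remaining coefficients play no role and may be set to $0$). Let $\bar C_i(\mathbf d)=C_i(\mathbf d,\hat b(\mathbf d),\hat w(\mathbf d))$. COS (choose offloading slice) algorithm: start from $\mathbf d=\mathbf d^0$ with $d^0_i=i$ for all $i$ (all WDs compute locally). While there is a WD $j$ whose decision $d_j$ does not minimize $d'_j\mapsto\bar C_j(d'_j,d_{-j})$ over $\mathfrak D_j$, select such a $j$ and replace $d_j$ by a minimizer $d_j^*\in\arg\min_{d'_j\in\mathfrak D_j}\bar C_j(d'_j,d_{-j})$. When no such WD exists, output $\mathbf d^*=\mathbf d$. Here $d_{-j}$ denotes the decisions of all WDs other than $j$. *)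

(* Defs.v *)
From HB Require Import structures.
From mathcomp Require Import all_boot all_order all_algebra.
From mathcomp Require Import classical_sets reals ereal.

Set Implicit Arguments.
Unset Strict Implicit.
Unset Printing Implicit Defensive.

Import Order.TTheory GRing.Theory Num.Theory.
Local Open Scope ring_scope.

Record slicing_system (R : realType) (N : nat) (A C S : finType) :=
  SlicingSystem {
    data_size : 'I_N -> R;             (* D_i *)
    rate : 'I_N -> A -> R;             (* R_{i,a} *)
    local_load : 'I_N -> R;            (* L_i *)
    slice_load : 'I_N -> S -> R;       (* L_{i,s} *)
    cloud_speed : C -> S -> R;         (* F_c^s *)
    local_speed : 'I_N -> R;           (* F_i^l *)
    data_size_gt0 : forall i, 0 < data_size i;
    rate_gt0 : forall i a, 0 < rate i a;
    local_load_gt0 : forall i, 0 < local_load i;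
    slice_load_gt0 : forall i s, 0 < slice_load i s;
    cloud_speed_gt0 : forall c s, 0 < cloud_speed c s;
    local_speed_gt0 : forall i, 0 < local_speed i
  }.

Section Model.
Variables (R : realType) (N : nat) (A C S : finType).
Variable M : slicing_system R N A C S.

(* [None] is the decision d_i = i (local computing); [Some (a, c, s)] is
   offloading through AP a to EC c in slice s. *)
Definition decision : finType := option (A * C * S).
Definition profile : finType := {ffun 'I_N -> decision}.

Definition local_time (i : 'I_N) : R := local_load M i / local_speed M i.

(* E_{i,e}^s. A resource e is an AP [inl a] or an EC [inr c]; at an AP this is a
   transmission time, the same for all slices. *)
Definition exec_time (i : 'I_N) (e : A + C) (s : S) : R :=
  match e with
  | inl a => data_size M i / rate M i a
  | inr c => slice_load M i s / cloud_speed M c s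
  end.

Definition uses (x : decision) (e : A + C) (s : S) : bool :=
  match x with
  | None => false
  | Some (a, c, s') =>
      (s' == s) && match e with inl a' => a == a' | inr c' => c == c' end
  end.

Definition offloaders (d : profile) (e : A + C) (s : S) : {set 'I_N} :=
  [set i | uses (d i) e s].

Definition local_devices (d : profile) : {set 'I_N} := [set i | d i == None].

Definition slice_coef := A -> S -> R.
Definition device_coef := 'I_N -> A + C -> S -> R.

(* b_e^s, which is 1 by convention at an EC *)
Definition resource_coef (b : slice_coef) (e : A + C) (s : S) : R :=
  match e with inl a => b a s | inr _ => 1 end.

(* E_{i,e}^s / (b_e^s w_{i,e}^s). The division is the one of [\bar R], where
   0^-1 = +oo; the division of [R] would give the value 0 instead. *)
Definition delay (b : slice_coef) (w : device_coef)
    (i : 'I_N) (e : A + C) (s : S) : \bar R :=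
  ((exec_time i e s)%:E / (resource_coef b e s * w i e s)%:E)%E.

Definition device_cost (d : profile) (b : slice_coef) (w : device_coef)
    (i : 'I_N) : \bar R :=
  match d i with
  | Some (a, c, s) => (delay b w i (inl a) s + delay b w i (inr c) s)%E
  | None => (local_time i)%:E
  end.

Definition system_cost (d : profile) (b : slice_coef) (w : device_coef) :
    \bar R :=
  (\sum_(s : S) \sum_(e : A + C) \sum_(i in offloaders d e s) delay b w i e s
   + \sum_(i in local_devices d) (local_time i)%:E)%E.

Record feasible (d : profile) (b : slice_coef) (w : device_coef) : Prop :=
  Feasible {
    feasible_cost : forall i, (device_cost d b w i <= (local_time i)%:E)%E;
    feasible_slice : forall a, \sum_(s : S) b a s <= 1;
    feasible_device : forall e s, \sum_(j in offloaders d e s) w j e s <= 1;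
    feasible_slice_ge0 : forall a s, 0 <= b a s;
    feasible_device_ge0 : forall i e s, 0 <= w i e s
  }.

Definition optimal_value : \bar R :=
  ereal_inf [set x | exists d b w, feasible d b w /\ x = system_cost d b w].

Definition approximate_solution (rho : R)
    (d : profile) (b : slice_coef) (w : device_coef) : Prop :=
  feasible d b w /\ (system_cost d b w <= rho%:E * optimal_value)%E.

Definition sqrt_load (d : profile) (e : A + C) (s : S) : R :=
  \sum_(j in offloaders d e s) Num.sqrt (exec_time j e s).

Definition opt_device_coef (d : profile) : device_coef := fun i e s =>
  if i \in offloaders d e s
  then Num.sqrt (exec_time i e s) / sqrt_load d e s
  else 0.

Definition opt_slice_coef (d : profile) : slice_coef := fun a s =>
  if [exists s', offloaders d (inl a) s' != finset.set0]
  then sqrt_load d (inl a) s / \sum_(s' : S) sqrt_load d (inl a) s'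
  else 0.

Definition opt_device_cost (d : profile) (i : 'I_N) : \bar R :=
  device_cost d (opt_slice_coef d) (opt_device_coef d) i.

Definition deviate (d : profile) (j : 'I_N) (x : decision) : profile :=
  [ffun i => if i == j then x else d i].

Definition best_response (d : profile) (j : 'I_N) (x : decision) : bool :=
  [forall y : decision,
    (opt_device_cost (deviate d j x) j <= opt_device_cost (deviate d j y) j)%E].

Definition all_local : profile := [ffun => None].

(* One iteration. Both the selected device and its minimizer are left open, so
   this is a relation and covers every selection and tie-breaking rule. *)
Definition cos_step : rel profile := fun d d' =>
  [exists j : 'I_N, exists x : decision,
    [&& ~~ best_response d j (d j), best_response d j x & d' == deviate d j x]].

Definition cos_terminates : Prop :=
  forall run : nat -> profile, run 0%N = all_local ->
    ~ (forall k, cos_step (run k) (run k.+1)).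

Definition cos_output (d : profile) : bool :=
  connect cos_step all_local d && [forall j, best_response d j (d j)].

(* The loop never blocks: it can only stop at a profile satisfying its exit
   condition. *)
Lemma cos_step_progress (d : profile) :
  ~~ [forall j, best_response d j (d j)] -> exists d', cos_step d d'.
Proof.
rewrite negb_forall => /existsP[j jNbest].
pose F x := opt_device_cost (deviate d j x) j.
have [x _ xmin] := @Order.TotalTheory.arg_minP _ _ decision None xpredT F isT.
exists (deviate d j x); apply/existsP; exists j; apply/existsP; exists x.
by rewrite jNbest eqxx andbT; apply/forallP => y; apply: xmin.
Qed.

End Model.

(* Main.v *)
(** With the optimal coefficients a device pays, at each resource r it uses,
    its weight sqrt(E) times the total weight L_r present on r: this is a
    weighted congestion game with linear latencies and resource-dependent
    weights. The potential sum_r (L_r^2 + sum_i w_(i,r)^2) + 2 * local times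
    changes by twice the change in cost of the deviating device, whence
    termination.
    At an equilibrium d, comparing with any profile d' gives
    cost d <= sum_r (L_r(d) L_r(d') + L_r(d')^2) + local times of d', and
    a b <= (3/10) a^2 + (5/6) b^2 yields cost d <= (55/21) cost d' with
    55/21 < 2.62. By Cauchy-Schwarz, cost d' bounds the cost of d' under
    arbitrary feasible coefficients from below. *)

Require Import Defs.
From mathcomp Require Import all_boot all_order all_algebra.
From mathcomp Require Import reals ereal.
From mathcomp Require Import ring lra.
Local Open Scope ring_scope.

Set Implicit Arguments.
Unset Strict Implicit.
Unset Printing Implicit Defensive.

Import Order.TTheory GRing.Theory Num.Theory.

(** Strict descent makes the points visited pairwise distinct, so the first [#|T|.+1] of them
    contradict the pigeonhole principle. *)
Lemma no_infinite_descent (R : realType) (T : finType) (f : T -> R)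
    (run : nat -> T) :
  ~ (forall k, f (run k.+1) < f (run k)).
Proof.
move=> desc.
have lt_run m n : (m < n)%N -> f (run n) < f (run m).
  elim: n => // n IHn; rewrite ltnS leq_eqVlt => /predU1P[-> //|/IHn].
  exact: lt_trans.
have inj : injective (fun k : 'I_#|T|.+1 => run k).
  move=> i j eq_run; apply: val_inj; case: (ltngtP i j) => // /lt_run.
    by rewrite eq_run ltxx.
  by rewrite eq_run ltxx.
by have := leq_card _ inj; rewrite card_ord ltnn.
Qed.

(** * Weighted congestion games with linear latencies: potential and equilibrium cost *)

Section CongestionGame.
Variables (R : realType) (I X Q : finType).
Variables (weight : X -> I -> Q -> R) (fixed : X -> I -> R).
Hypothesis weight_ge0 : forall x i r, 0 <= weight x i r.
Hypothesis fixed_ge0 : forall x i, 0 <= fixed x i.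
Implicit Types (d : {ffun I -> X}) (x : X).

Definition load d r : R := \sum_i weight (d i) i r.

Definition game_cost d i : R :=
  \sum_r weight (d i) i r * load d r + fixed (d i) i.

Definition switch d j x : {ffun I -> X} :=
  [ffun i => if i == j then x else d i].

(** A weight w arriving on a resource raises the squared load by 2 w L - w^2, with L the load after
    arrival; the individual squares complete this to 2 w L. *)
Definition potential d : R :=
  \sum_r (load d r ^+ 2 + \sum_i weight (d i) i r ^+ 2)
  + 2 * \sum_i fixed (d i) i.

Lemma sum_switch d j x (g : X -> I -> R) :
  \sum_i g (switch d j x i) i = \sum_i g (d i) i - g (d j) j + g x j.
Proof.
rewrite (bigD1 j) //= [in RHS](bigD1 j) //= ffunE eqxx.
rewrite (eq_bigr (fun i => g (d i) i)); first by ring.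
by move=> i /negPf nij; rewrite ffunE nij.
Qed.

Lemma load_switch d j x r :
  load (switch d j x) r = load d r - weight (d j) j r + weight x j r.
Proof. exact: (sum_switch d j x (fun y i => weight y i r)). Qed.

Lemma potential_switch d j x :
  potential (switch d j x) - potential d =
  2 * (game_cost (switch d j x) j - game_cost d j).
Proof.
rewrite /potential /game_cost (sum_switch d j x fixed) !ffunE eqxx.
transitivity (\sum_r (2 * (weight x j r * load (switch d j x) r)
    - 2 * (weight (d j) j r * load d r))
    + 2 * (fixed x j - fixed (d j) j)); last first.
  by rewrite sumrB -!mulr_sumr; ring.
rewrite (eq_bigr (fun r => (load d r ^+ 2 + \sum_i weight (d i) i r ^+ 2) +
    (2 * (weight x j r * load (switch d j x) r)
    - 2 * (weight (d j) j r * load d r)))).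
  by rewrite big_split /=; ring.
move=> r _; rewrite (sum_switch d j x (fun y i => weight y i r ^+ 2)).
by rewrite load_switch; ring.
Qed.

Lemma sum_game_cost d :
  \sum_i game_cost d i = \sum_r load d r ^+ 2 + \sum_i fixed (d i) i.
Proof.
rewrite big_split /= exchange_big /=; congr (_ + _).
by apply: eq_bigr => r _; rewrite -mulr_suml expr2.
Qed.

Lemma sum_sqr_weight_le d r :
  \sum_i weight (d i) i r ^+ 2 <= load d r ^+ 2.
Proof.
rewrite [X in _ <= X]expr2 {1}/load mulr_suml; apply: ler_sum => i _.
rewrite expr2 ler_wpM2l // /load (bigD1 i) //= lerDl.
exact: sumr_ge0.
Qed.

(** The mover meets at most the old load plus its own new weight, since its old weight can only have
    left. *)
Lemma switch_cost_le d j x :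
  game_cost (switch d j x) j <=
  \sum_r (weight x j r * load d r + weight x j r ^+ 2) + fixed x j.
Proof.
rewrite /game_cost !ffunE eqxx lerD2r; apply: ler_sum => r _.
rewrite expr2 -mulrDr ler_wpM2l // load_switch lerD2r.
by rewrite lerBlDr lerDl.
Qed.

Lemma equilibrium_cost_le d d' :
  (forall j x, game_cost d j <= game_cost (switch d j x) j) ->
  \sum_i game_cost d i <= 55 / 21 * \sum_i game_cost d' i.
Proof.
move=> nash.
have le_dev : \sum_i game_cost d i <=
    \sum_r (load d' r * load d r + load d' r ^+ 2) + \sum_i fixed (d' i) i.
  apply: (@le_trans _ _ (\sum_i (\sum_r (weight (d' i) i r * load d r
      + weight (d' i) i r ^+ 2) + fixed (d' i) i))).
    by apply: ler_sum => i _; apply: le_trans (nash i (d' i)) (switch_cost_le _ _ _).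
  rewrite big_split /= lerD2r exchange_big /=; apply: ler_sum => r _.
  by rewrite big_split /= -mulr_suml lerD2l sum_sqr_weight_le.
have young : \sum_r (load d' r * load d r + load d' r ^+ 2) <=
    3 / 10 * \sum_r load d r ^+ 2 + 11 / 6 * \sum_r load d' r ^+ 2.
  rewrite !mulr_sumr -big_split /=; apply: ler_sum => r _.
  (* This square gives a b <= 3/10 a^2 + 5/6 b^2. Optimising the split would give the ratio (3 +
     sqrt 5)/2; 3/10 is a rational value near the optimum. *)
  have := sqr_ge0 (3 * load d r - 5 * load d' r).
  by nra.
have f0 (e : {ffun I -> X}) : 0 <= \sum_i fixed (e i) i by exact: sumr_ge0.
(* Absorbing 3/10 on the left leaves the ratio (11/6) / (7/10) = 55/21; the fixed costs, being
   nonnegative, only help. *)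
move: le_dev young (f0 d) (f0 d'); rewrite !sum_game_cost.
by lra.
Qed.

End CongestionGame.

(** * The slicing system with optimal coefficients as a congestion game *)

Section SlicingGame.
Variables (R : realType) (N : nat) (A C S : finType).
Variable M : slicing_system R N A C S.
Implicit Types (d : profile N A C S) (x : decision A C S) (i j : 'I_N).

(** An offloading device occurs at exactly two pairs (e, s), its AP and its EC. The operation is
    general so as to cover costs in [\bar R] and penalties in [R]. *)
Lemma big_offloaders (T : Type) (idx : T) (op : Monoid.com_law idx) d
    (F : 'I_N -> A + C -> S -> T) :
  \big[op/idx]_s \big[op/idx]_e \big[op/idx]_(i in offloaders d e s) F i e s =
  \big[op/idx]_i match d i with
    | Some (a, c, s) => op (F i (inl a) s) (F i (inr c) s)
    | None => idx
    end.
Proof.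
pose G i e s := if uses (d i) e s then F i e s else idx.
transitivity (\big[op/idx]_i \big[op/idx]_s \big[op/idx]_e G i e s).
  rewrite [RHS]exchange_big /=; apply: eq_bigr => s _.
  rewrite [RHS]exchange_big /=; apply: eq_bigr => e _.
  by rewrite big_mkcond /=; apply: eq_bigr => i _; rewrite inE.
apply: eq_bigr => i _; rewrite /G; case: (d i) => [[[a c] s]|] /=; last first.
  by rewrite big1 // => s _; rewrite big1.
rewrite (bigD1 s) //= [X in op _ X]big1 ?Monoid.mulm1; last first.
  by move=> s' ns; rewrite big1 // => e _; rewrite eq_sym (negPf ns).
rewrite eqxx /= big_sumType /=; congr (op _ _).
- rewrite (bigD1 a) //= eqxx big1 ?Monoid.mulm1 // => a' na.
  by rewrite eq_sym (negPf na).
- rewrite (bigD1 c) //= eqxx big1 ?Monoid.mulm1 // => c' nc.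
  by rewrite eq_sym (negPf nc).
Qed.

Lemma system_costE d b w :
  system_cost M d b w = (\sum_i device_cost M d b w i)%E.
Proof.
rewrite /system_cost big_offloaders [X in (_ + X)%E]big_mkcond -big_split /=.
apply: eq_bigr => i _; rewrite inE /device_cost.
by case: (d i) => [[[a c] s]|] /=; rewrite ?adde0 ?add0e.
Qed.

(* Resources are APs and pairs (EC, slice): once the inter-slice coefficients
   are optimal, the slices of an AP behave as a single shared resource. *)
Definition resource : finType := (A + C * S)%type.

Definition dev_weight x i (r : resource) : R :=
  match x with
  | Some (a, c, s) =>
      (r == inl a)%:R * Num.sqrt (exec_time M i (inl a) s)
      + (r == inr (c, s))%:R * Num.sqrt (exec_time M i (inr c) s)
  | None => 0
  end.

Definition dev_fixed x i : R := if x is None then local_time M i else 0.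

Lemma exec_time_gt0 i e s : 0 < exec_time M i e s.
Proof.
case: e => [a|c] /=; apply: divr_gt0.
- exact: data_size_gt0.
- exact: rate_gt0.
- exact: slice_load_gt0.
- exact: cloud_speed_gt0.
Qed.

Lemma dev_weight_ge0 x i r : 0 <= dev_weight x i r.
Proof. by case: x => [[[a c] s]|] /=. Qed.

Lemma dev_fixed_ge0 x i : 0 <= dev_fixed x i.
Proof.
case: x => //=; apply: divr_ge0; apply: ltW.
  exact: local_load_gt0.
exact: local_speed_gt0.
Qed.

Lemma sum_dev_weight a c s i (g : resource -> R) :
  \sum_r dev_weight (Some (a, c, s)) i r * g r =
  Num.sqrt (exec_time M i (inl a) s) * g (inl a)
  + Num.sqrt (exec_time M i (inr c) s) * g (inr (c, s)).
Proof.
have pick (q : resource) (t : R) : \sum_r (r == q)%:R * t * g r = t * g q.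
  rewrite (bigD1 q) //= eqxx mul1r big1 ?addr0 // => r /negPf ->.
  by rewrite !mul0r.
rewrite -!pick -big_split /=.
by apply: eq_bigr => r _; rewrite mulrDl.
Qed.

Notation dload := (load dev_weight).
Notation dcost := (game_cost dev_weight dev_fixed).

Lemma load_cloud d c s : dload d (inr (c, s)) = sqrt_load M d (inr c) s.
Proof.
rewrite /load /sqrt_load [RHS]big_mkcond /=; apply: eq_bigr => i _.
rewrite inE; case: (d i) => [[[a' c'] s']|] //=.
rewrite mul0r add0r.
rewrite (_ : (inr (c, s) == inr (c', s') :> resource) = (s' == s) && (c' == c)).
  by case: eqP => [->|_]; case: eqP => [->|_]; rewrite /= ?mul1r ?mul0r.
by rewrite -[LHS]/((c == c') && (s == s')) andbC eq_sym [c == _]eq_sym.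
Qed.

Lemma load_access d a : dload d (inl a) = \sum_s sqrt_load M d (inl a) s.
Proof.
under [RHS]eq_bigr do rewrite /sqrt_load big_mkcond /=.
rewrite [RHS]exchange_big /=; apply: eq_bigr => i _.
under eq_bigr do rewrite inE.
case: (d i) => [[[a' c'] s']|] /=; last by rewrite big1.
rewrite (bigD1 s') //= eqxx big1 ?addr0; last first.
  by move=> s /negPf; rewrite eq_sym => ->.
rewrite mul0r addr0 -[inl a == _]/(a == a') eq_sym.
by case: eqP => [->|_]; rewrite /= ?mul1r ?mul0r.
Qed.

Lemma sqrt_load_ge0 d e s : 0 <= sqrt_load M d e s.
Proof. by apply: sumr_ge0 => i _; rewrite sqrtr_ge0. Qed.

Lemma sqrt_load_gt0 d e s i : i \in offloaders d e s -> 0 < sqrt_load M d e s.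
Proof.
move=> di; rewrite /sqrt_load (bigD1 i) //= ltr_wpDr //.
  by apply: sumr_ge0 => j _; rewrite sqrtr_ge0.
by rewrite sqrtr_gt0 exec_time_gt0.
Qed.

Definition resource_at (e : A + C) (s : S) : resource :=
  match e with inl a => inl a | inr c => inr (c, s) end.

(** At an AP the slice load cancels in the product of the two coefficients, leaving sqrt(E) over the
    load of the whole AP. *)
Lemma opt_delayE d i e s : i \in offloaders d e s ->
  delay M (opt_slice_coef M d) (opt_device_coef M d) i e s =
  (Num.sqrt (exec_time M i e s) * dload d (resource_at e s))%:E.
Proof.
move=> die; have l0 := sqrt_load_gt0 die; have E0 := exec_time_gt0 i e s.
have q0 : 0 < Num.sqrt (exec_time M i e s) by rewrite sqrtr_gt0.
have qE := sqr_sqrtr (ltW E0).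
suff [L0 coefE] : 0 < dload d (resource_at e s) /\
    resource_coef (opt_slice_coef M d) e s * opt_device_coef M d i e s =
    Num.sqrt (exec_time M i e s) / dload d (resource_at e s).
  rewrite /delay coefE inver gt_eqF ?divr_gt0 // -EFinM; congr (_%:E).
  by rewrite -[X in X * _]qE; field; rewrite !gt_eqF.
rewrite /opt_device_coef die; case: e die l0 {E0 q0 qE} => [a|c] die l0 /=.
  rewrite load_access; split.
    by rewrite (bigD1 s) //= ltr_wpDr // sumr_ge0 // => s' _; exact: sqrt_load_ge0.
  rewrite /opt_slice_coef ifT; last first.
    by apply/existsP; exists s; apply/set0Pn; exists i.
  by rewrite mulrC mulrA divfK ?gt_eqF.
by rewrite load_cloud mul1r.
Qed.

Lemma opt_device_costE d i : opt_device_cost M d i = (dcost d i)%:E.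
Proof.
rewrite /opt_device_cost /device_cost /game_cost.
case Ed: (d i) => [[[a c] s]|] /=; last first.
  by rewrite big1 ?add0r // => r _; rewrite mul0r.
by rewrite addr0 sum_dev_weight !opt_delayE ?inE ?Ed /= ?eqxx.
Qed.

(** * Best responses: descent of the potential and feasibility of equilibria *)

Lemma best_responseP d j x :
  reflect (forall y, dcost (switch d j x) j <= dcost (switch d j y) j)
          (best_response M d j x).
Proof.
apply: (iffP forallP) => h y; move: (h y).
  by rewrite !opt_device_costE lee_fin.
by rewrite !opt_device_costE lee_fin.
Qed.

Lemma switch_id d j : switch d j (d j) = d.
Proof. by apply/ffunP => i; rewrite ffunE; case: eqP => [->|]. Qed.

Lemma cos_step_potential d d' : cos_step M d d' ->
  potential dev_weight dev_fixed d' < potential dev_weight dev_fixed d.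
Proof.
case/existsP=> j /existsP[x /and3P[nbest /best_responseP best /eqP->]].
rewrite -subr_lt0 (potential_switch _ _ d j x) pmulr_rlt0 // subr_lt0.
(* Were the move not strictly profitable, the old decision would already be a minimizer. *)
rewrite ltNge; apply: contra nbest => le_cost.
apply/best_responseP => y; rewrite switch_id.
exact: le_trans le_cost (best y).
Qed.

Lemma opt_coef_feasible d : (forall j, best_response M d j (d j)) ->
  feasible M d (opt_slice_coef M d) (opt_device_coef M d).
Proof.
move=> nash.
(* At [t = 0] the quotient is 0, which covers slices without offloaders. *)
have divff_le1 (t : R) : t / t <= 1.
  by have [->|nt] := eqVneq t 0; rewrite ?mul0r ?ler01 ?divff.
split.
- move=> i; rewrite -/(opt_device_cost M d i) opt_device_costE lee_fin.
  (* Constraint (i) comes from equilibrium: local computing is an available deviation. *)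
  have /best_responseP/(_ None) := nash i; rewrite switch_id => /le_trans; apply.
  by rewrite /game_cost ffunE eqxx big1 ?add0r // => r _; rewrite mul0r.
- move=> a; rewrite /opt_slice_coef.
  case: [exists s', _]; last by rewrite big1 // ler01.
  by rewrite -mulr_suml.
- move=> e s; rewrite /opt_device_coef.
  by under eq_bigr => i di do rewrite di; rewrite -mulr_suml.
- move=> a s; rewrite /opt_slice_coef; case: ifP => // _.
  by rewrite divr_ge0 ?sqrt_load_ge0 ?sumr_ge0 // => s' _; exact: sqrt_load_ge0.
- move=> i e s; rewrite /opt_device_coef; case: ifP => // _.
  by rewrite divr_ge0 ?sqrtr_ge0 ?sqrt_load_ge0.
Qed.

(** * Lower bound on the cost under arbitrary feasible coefficients *)

(* Tangent form of Cauchy-Schwarz: taking [t] to be the load of the resource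
   and summing gives the optimal cost, and the junk case of a zero coefficient
   needs no separate treatment. *)
Lemma delay_ge_tangent b w i e s (t : R) :
  0 <= resource_coef b e s * w i e s ->
  ((2 * (Num.sqrt (exec_time M i e s) * t)
    - t ^+ 2 * (resource_coef b e s * w i e s))%:E <= delay M b w i e s)%E.
Proof.
rewrite /delay; set v := _ * w i e s => v0.
have E0 := exec_time_gt0 i e s.
rewrite inver; case: eqP => [_|/eqP nv]; first by rewrite gt0_muley ?lte_fin ?leey.
have {nv}v0 : 0 < v by rewrite lt_def nv.
rewrite -EFinM lee_fin ler_pdivlMr // -[X in _ <= X](sqr_sqrtr (ltW E0)).
have := sqr_ge0 (Num.sqrt (exec_time M i e s) - t * v).
by nra.
Qed.

Lemma resource_coef_ge0 d b w (e : A + C) s :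
  feasible M d b w -> 0 <= resource_coef b e s.
Proof. by case: e => [a|c] //= f; apply: feasible_slice_ge0 f a s. Qed.

(** The budgets nest: device coefficients sum to at most 1 within a slice, then slice coefficients
    do so within an AP; at an EC each slice is its own resource. *)
Lemma sum_coef_le d b w (g : resource -> R) : feasible M d b w ->
  (forall r, 0 <= g r) ->
  \sum_s \sum_e \sum_(i in offloaders d e s)
    g (resource_at e s) * (resource_coef b e s * w i e s) <= \sum_r g r.
Proof.
move=> f g0.
apply: (@le_trans _ _ (\sum_s \sum_e g (resource_at e s) * resource_coef b e s)).
  apply: ler_sum => s _; apply: ler_sum => e _.
  rewrite -mulr_sumr ler_wpM2l // -mulr_sumr ler_piMr //.
    exact: resource_coef_ge0 f.
  exact: feasible_device f e s.
under eq_bigr do rewrite big_sumType /=.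
rewrite big_split /= [X in _ <= X]big_sumType /=; apply: lerD.
  rewrite exchange_big /=; apply: ler_sum => a _.
  by rewrite -mulr_sumr ler_piMr // (feasible_slice f).
rewrite exchange_big pair_big /=.
by apply: ler_sum => -[c s] _; rewrite mulr1.
Qed.

Lemma system_cost_ge d b w : feasible M d b w ->
  ((\sum_i dcost d i)%:E <= system_cost M d b w)%E.
Proof.
move=> f.
(* [v] is the subtracted term of the tangent bound. Its total is at most the sum of the squared
   loads, so one of the two copies in the linear term survives. *)
pose v i e s := dload d (resource_at e s) ^+ 2 * (resource_coef b e s * w i e s).
pose pen i := match d i with
  | Some (a, c, s) => v i (inl a) s + v i (inr c) s | None => 0 end.
have penle : \sum_i pen i <= \sum_r dload d r ^+ 2.
  rewrite /pen -(big_offloaders _ d v).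
  by apply: (sum_coef_le (g := fun r => dload d r ^+ 2) f) => r; exact: sqr_ge0.
apply: (@le_trans _ _ (\sum_i (2 * (\sum_r dev_weight (d i) i r * dload d r)
    + dev_fixed (d i) i - pen i))%:E).
  rewrite sum_game_cost lee_fin sumrB big_split /= -mulr_sumr exchange_big /=.
  have -> : \sum_r \sum_i dev_weight (d i) i r * dload d r =
      \sum_r dload d r ^+ 2.
    by apply: eq_bigr => r _; rewrite -mulr_suml expr2.
  by lra.
rewrite system_costE -sumEFin; apply: lee_sum => i _.
have c0 e s : 0 <= resource_coef b e s * w i e s.
  by rewrite mulr_ge0 ?(resource_coef_ge0 _ _ f) ?(feasible_device_ge0 f).
rewrite /pen /device_cost; case: (d i) => [[[a c] s]|] /=; last first.
  by rewrite big1 ?mulr0 ?add0r ?subr0 // => r _; rewrite mul0r.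
rewrite addr0 sum_dev_weight.
apply: le_trans (leeD (delay_ge_tangent (dload d (inl a)) (c0 (inl a) s))
  (delay_ge_tangent (dload d (inr (c, s))) (c0 (inr c) s))).
by rewrite -EFinD lee_fin /v /=; lra.
Qed.

End SlicingGame.

Theorem theorem10 (R : realType) (N : nat) (A C S : finType)
    (M : slicing_system R N A C S) :
  cos_terminates M /\
  (forall d : profile N A C S, cos_output M d ->
     approximate_solution M (262%:R / 100%:R) d
       (opt_slice_coef M d) (opt_device_coef M d)).
Proof.
split.
  move=> run _ step.
  apply: (@no_infinite_descent _ _ (potential (dev_weight M) (dev_fixed M)) run).
  by move=> k; exact: cos_step_potential.
move=> d /andP[_ /forallP nash]; split; first exact: opt_coef_feasible.
rewrite system_costE.
under eq_bigr do rewrite -/(opt_device_cost M d _) opt_device_costE.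
(* Dividing by the ratio leaves a lower bound on the infimum, to be checked at each feasible
   triple. *)
rewrite sumEFin -lee_pdivrMl; last by lra.
rewrite -EFinM; apply/ereal_infP => _ [d' [b [w [f ->]]]].
apply: le_trans (system_cost_ge f); rewrite lee_fin.
have nash' j x : game_cost (dev_weight M) (dev_fixed M) d j <=
    game_cost (dev_weight M) (dev_fixed M) (switch d j x) j.
  by have /best_responseP/(_ x) := nash j; rewrite switch_id.
have := equilibrium_cost_le (dev_weight_ge0 M) (dev_fixed_ge0 M) d' nash'.
(* Nonnegativity allows 55/21 to be relaxed to 262/100. *)
have : 0 <= \sum_i game_cost (dev_weight M) (dev_fixed M) d' i.
  rewrite sum_game_cost addr_ge0 // sumr_ge0 // => i _; first exact: sqr_ge0.
  exact: dev_fixed_ge0.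
by lra.
Qed.
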